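(* For every natural number $l$, the double subdivided star $T_{l,l}$ exhibits pretty good state transfer between its two coalescence vertices $a$ and $b$ with respect to a sequence in $(4\mathbb{Z}-1)\frac{\pi}{2}$; that is, there is a sequence $(\tau_k)$ with each $\tau_k\in\{(4n-1)\pi/2: n\in\mathbb{Z}\}$ and some $\gamma\in\mathbb{C}$ such that $\lim_{k\to\infty}U(\tau_k)\mathbf{e}_a=\gamma\mathbf{e}_b$.
   Context: A subdivided star $SK_{1,l}$ is obtained by identifying exactly one pendant (end) vertex from each of $l$ copies of the path $P_3$; the identified vertex is the coalescence vertex. The double subdivided star $T_{l,m}$ is obtained from $SK_{1,l}$ and $SK_{1,m}$ by adding one edge joining their two coalescence vertices; in $T_{l,l}$ these are the two vertices of degree $l+1$ joined by that edge (for $l=1$, the two middle vertices of the path $P_6$). For a graph with adjacency matrix $A$, $U(t)=\exp(itA)$, $t\in\mathbb{R}$, and $\mathbf{e}_a$ is the standard basis vector of vertex $a$. Pretty good state transfer between distinct vertices $a,b$ means there exist real $\tau_k$ and $\gamma\in\mathbb{C}$ with $\lim_{k\to\infty}U(\tau_k)\mathbf{e}_a=\gamma\mathbf{e}_b$. *)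

(* Defs.v *)
From HB Require Import structures.
From mathcomp Require Import all_boot all_order all_algebra.
From mathcomp Require Import all_classical all_reals all_analysis.
From mathcomp Require Import complex.
Set Implicit Arguments. Unset Strict Implicit. Unset Printing Implicit Defensive.
Import Order.TTheory GRing.Theory Num.Theory.
Import numFieldNormedType.Exports.
Local Open Scope ring_scope.
Local Open Scope complex_scope.
Local Open Scope classical_set_scope.

(* Vertices of the double subdivided star T_{l,l}.
   A vertex is (s, v) with s : bool the side (the copy SK_{1,l}), and
   v = None            : the coalescence vertex of side s,
   v = Some (i, false) : the middle vertex of the i-th copy of P_3,
   v = Some (i, true)  : the far pendant vertex of the i-th copy of P_3. *)
Definition Tvert (l : nat) : finType := (bool * option ('I_l * bool))%type.

Definition Tedge0 (l : nat) (x y : Tvert l) : bool :=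
  match x, y with
  | (false, None), (true, None) => true
  | (s, None), (s', Some (_, false)) => s == s'
  | (s, Some (i, false)), (s', Some (j, true)) => (s == s') && (i == j)
  | _, _ => false
  end.

Definition Tadj (l : nat) : rel (Tvert l) :=
  fun x y => Tedge0 x y || Tedge0 y x.

Definition coal_a (l : nat) : Tvert l := (false, None).
Definition coal_b (l : nat) : Tvert l := (true, None).

(* the complex numbers R[i], viewed as a numFieldType so that they carry the
   norm topology (|z| = complex modulus) of MathComp-Analysis *)
Definition Cx (R : realType) : numFieldType := R[i].

Definition Tn (l : nat) : nat := #|{: Tvert l}|.

Definition Tadjmx (R : realType) (l : nat) : 'M[Cx R]_(Tn l) :=
  \matrix_(i, j) (Tadj (enum_val i) (enum_val j))%:R.

Definition evec (R : realType) (l : nat) (x : Tvert l) : 'cV[Cx R]_(Tn l) :=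
  delta_mx (enum_rank x) 0.

Definition expmx_partial (K : numFieldType) (n : nat) (M : 'M[K]_n) (N : nat)
  : 'M[K]_n := \sum_(k < N) ((k`!%:R)^-1 *: M ^+ k).

Definition expmx (K : numFieldType) (n : nat) (M : 'M[K]_n) : 'M[K]_n :=
  lim (expmx_partial M @ \oo).

Definition Umx (R : realType) (n : nat) (A : 'M[Cx R]_n) (t : R) : 'M[Cx R]_n :=
  expmx ((('i : Cx R) * (t%:C : Cx R)) *: A).

(* Main.v *)
Require Import Defs.
From HB Require Import structures.
From mathcomp Require Import all_boot all_order all_algebra.
From mathcomp Require Import all_classical all_reals all_analysis.
From mathcomp Require Import complex.
From mathcomp Require Import ring lra zify.
Import Order.TTheory GRing.Theory Num.Theory.
Import numFieldNormedType.Exports.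
Import ComplexField.Normc.
Local Open Scope ring_scope.
Local Open Scope complex_scope.
Local Open Scope classical_set_scope.

(* Swapping the two sides of T_{l,l} splits the relevant part of the adjacency
   matrix into a symmetric and an antisymmetric 3 x 3 block. The symmetric
   eigenvalues are the roots x, y, z of p = X^3 - X^2 - (l+1) X + 1, and the
   antisymmetric ones are their opposites. Hence e_a and e_b are the sum and
   the difference of a symmetric and an antisymmetric part, and it suffices to
   find times t = (4 n - 1) pi / 2 with exp(i t x), exp(i t y), exp(i t z) all
   close to i: then U(t) e_a is close to i e_b. Since x + y + z = 1 and
   exp(i t) = - i, only x and y matter. The cubic p is irreducible over the
   rationals, which makes 1, x, y linearly independent over the rationals, and
   Kronecker's theorem provides n. *)

(** * The cubic and its roots *)

Definition dstar_poly (F : nzRingType) (l : nat) : {poly F} :=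
  'X^3 - 'X^2 - l.+1%:R *: 'X + 1.

Lemma horner_dstar_poly (F : comNzRingType) l (x : F) :
  (dstar_poly F l).[x] = x ^+ 3 - x ^+ 2 - l.+1%:R * x + 1.
Proof. by rewrite /dstar_poly !hornerE /= ?hornerXn. Qed.

Lemma size_dstar_poly (F : nzRingType) l : size (dstar_poly F l) = 4%N.
Proof.
rewrite /dstar_poly -!addrA size_polyDl ?size_polyXn //.
rewrite (leq_ltn_trans (size_polyD _ _)) // gtn_max size_polyN size_polyXn /=.
rewrite (leq_ltn_trans (size_polyD _ _)) // gtn_max size_polyN size_poly1 andbT.
by rewrite (leq_ltn_trans (size_scale_leq _ _)) // size_polyX.
Qed.

Lemma map_dstar_poly (F : numFieldType) l :
  map_poly (@ratr F) (dstar_poly rat l) = dstar_poly F l.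
Proof.
rewrite /dstar_poly !(rmorphD, rmorphN, rmorph1) /= !map_polyXn map_polyZ.
by rewrite /= map_polyX ratr_nat.
Qed.

(* Both the numerator and the denominator of a rational root divide 1. *)
Lemma dstar_poly_noroot l (x : rat) : (0 < l)%N -> ~~ root (dstar_poly rat l) x.
Proof.
move=> l0; apply/negP; rewrite /root horner_dstar_poly => /eqP px.
have := coprime_num_den x; have := denq_gt0 x; have := divq_num_den x.
move: (numq x) (denq x) => n d xE d_gt0 cop.
have d0 : d%:Q != 0 by rewrite intr_eq0 gt_eqF.
move: px; rewrite -xE => /(congr1 (fun t => t * d%:Q ^+ 3)); rewrite mul0r.
have -> : ((n%:Q / d%:Q) ^+ 3 - (n%:Q / d%:Q) ^+ 2 - l.+1%:R * (n%:Q / d%:Q) + 1)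
   * d%:Q ^+ 3 = (n ^+ 3 - n ^+ 2 * d - l.+1%:R * n * d ^+ 2 + d ^+ 3)%:~R.
  rewrite !(rmorphD, rmorphN, rmorphM, rmorphXn) /=.
  have -> : (l.+1%:R : int)%:~R = l.+1%:R :> rat by rewrite rmorph_nat.
  by field.
move/eqP; rewrite intr_eq0 => /eqP e.
have unit_dvd (u v : int) : coprime `|u| `|v| -> (u %| v ^+ 3)%Z -> `|u|%N = 1%N.
  move=> cuv; rewrite dvdzE abszX => uv.
  by apply/eqP; rewrite -dvdn1 -(Gauss_dvdr 1 (coprimeXr 3 cuv)) muln1.
have n1 : `|n|%N = 1%N.
  apply: (unit_dvd _ d) => //; apply/dvdzP.
  exists (- (n ^+ 2 - n * d - l.+1%:R * d ^+ 2)); apply/eqP; rewrite -subr_eq0.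
  by apply/eqP; rewrite -[RHS]e; ring.
have d1 : d = 1.
  have : `|d|%N = 1%N.
    apply: (unit_dvd _ n); first by rewrite coprime_sym.
    apply/dvdzP; exists (n ^+ 2 + l.+1%:R * n * d - d ^+ 2).
    by apply/eqP; rewrite -subr_eq0; apply/eqP; rewrite -[RHS]e; ring.
  by move=> d1; rewrite -[d]gtz0_abs // d1.
(* A rational root is thus 1 or -1, where the cubic takes the values -l and l, nonzero since l >
   0. *)
have : (n == 1) || (n == -1) by lia.
have lS : l.+1%:R = l%:Z + 1 :> int by rewrite -natr1 natz.
by case/orP => /eqP nE; move: e; rewrite d1 nE lS; lia.
Qed.

Lemma dstar_poly_irreducible l :
  (0 < l)%N -> irreducible_poly (dstar_poly rat l).
Proof.
move=> l0; apply: cubic_irreducible; first by rewrite size_dstar_poly.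
by move=> x; exact: dstar_poly_noroot.
Qed.

(** If [p] does not divide [q], irreducibility makes them coprime over the rationals; coprimality
    persists in [F] and forbids a common root. *)
Lemma irreducible_root_size (F : numFieldType) (p q : {poly rat}) (x : F) :
  irreducible_poly p -> root (map_poly ratr p) x -> root (map_poly ratr q) x ->
  q != 0 -> (size p <= size q)%N.
Proof.
move=> pirr px qx q0; case: (boolP (p %| q)) => [pq|]; first exact: dvdp_leq.
rewrite -(irreducible_poly_coprime _ pirr) -(coprimep_map (@ratr F)).
by move=> /coprimep_root /(_ px); rewrite -rootE qx.
Qed.

(** The root [x] has degree 3 over the rationals: a nonzero polynomial with coefficients w, v, u has
    size at most 3, below the size 4 of the irreducible cubic. *)
Lemma dstar_quadratic (F : numFieldType) l (x : F) (u v w : rat) : (0 < l)%N ->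
  root (dstar_poly F l) x -> ratr u * x ^+ 2 + ratr v * x + ratr w = 0 ->
  [/\ u = 0, v = 0 & w = 0].
Proof.
move=> l0 px e; pose q := Poly [:: w; v; u].
have [q0|q0] := eqVneq q 0.
  have c i : q`_i = 0 by rewrite q0 coef0.
  by move: (c 0%N) (c 1%N) (c 2%N); rewrite !coef_Poly.
have := @irreducible_root_size F _ q x (dstar_poly_irreducible _ l0).
rewrite map_dstar_poly size_dstar_poly => /(_ px); suff qx : root (map_poly ratr q) x.
  by move=> /(_ qx q0) /leq_trans /(_ (size_Poly _)).
rewrite rootE map_Poly_id0 ?rmorph0 // horner_Poly /=.
by apply/eqP; rewrite -[RHS]e; ring.
Qed.

(* Substituting y = r + s x into the second elementary symmetric function of
   the roots gives a rational quadratic equation for x, whose leading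
   coefficient - (s ^ 2 + s + 1) does not vanish. *)
Lemma dstar_roots_free (F : numFieldType) l (x y : F) (a b c : int) : (0 < l)%N ->
  root (dstar_poly F l) x ->  root (dstar_poly F l) y -> x != y ->
  a%:~R * x + b%:~R * y = c%:~R -> a = 0 /\ b = 0.
Proof.
move=> l0 px py xy e.
have [b0|b0] := eqVneq b 0.
  have [_ /eqP] : [/\ 0 = 0 :> rat, a%:~R = 0 :> rat & (- c%:~R) = 0 :> rat].
    apply: (@dstar_quadratic F l x) => //.
    by rewrite rmorphN rmorph0 /= !ratr_int -e b0; ring.
  by rewrite intr_eq0 => /eqP.
have bF : b%:~R != 0 :> F by rewrite intr_eq0.
pose r : rat := c%:~R / b%:~R; pose s : rat := - a%:~R / b%:~R.
have ey : y = ratr r + ratr s * x.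
  apply: (mulfI bF); rewrite /r /s !rmorphM /= !fmorphV rmorphN /= !ratr_int.
  by rewrite -e; field.
clearbody r s.
(* This is p(x) - p(y) divided by x - y. *)
have e2 : x ^+ 2 + x * y + y ^+ 2 - (x + y) - l.+1%:R = 0.
  apply: (mulfI (_ : x - y != 0)); first by rewrite subr_eq0.
  move: px py; rewrite /root !horner_dstar_poly => /eqP px /eqP py.
  by rewrite mulr0 -[RHS](subrr 0) -[X in _ = X - _]px -[X in _ = _ - X]py; ring.
have [/eqP] : [/\ s ^+ 2 + s + 1 = 0, (s *+ 2 + 1) * r - (s + 1) = 0
         & r ^+ 2 - r - l.+1%:R = 0].
  apply: (@dstar_quadratic F l x) => //.
  rewrite !(rmorphD, rmorphN, rmorphM, rmorphXn, rmorphMn, rmorph1, ratr_nat) /=.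
  by rewrite -[RHS]e2 ey; ring.
have s1 : s ^+ 2 + s + 1 > 0 by nra.
by rewrite gt_eqF.
Qed.

(** The cubic is negative at -(l + 2), equal to 1 at 0 and to -l at 1, so it has a root on each side
    of 0. *)
Lemma dstar_roots (R : realType) l : (0 < l)%N ->
  exists x y : R, [/\ root (dstar_poly R l) x, root (dstar_poly R l) y & x < y].
Proof.
move=> l0.
have l1 : 1 <= l%:R :> R by rewrite ler1n.
have eS : l.+1%:R = l%:R + 1 :> R by rewrite natr1.
have [||x /andP[x1 x0] px] := @poly_ivt R (dstar_poly R l) (- (l%:R + 2)) 0.
- by nra.
- rewrite !horner_dstar_poly eS; apply/andP; split; nra.
have [||y /andP[y0 y1] py] := @poly_ivt R (- dstar_poly R l) 0 1.
- by [].
- rewrite !hornerN !horner_dstar_poly eS; apply/andP; split; nra.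
exists x, y; split=> //; first by rewrite rootN in py.
rewrite lt_neqAle (le_trans x0 y0) andbT; apply/eqP => xy.
have x00 : x = 0 by apply/eqP; rewrite eq_le x0 xy.
by move: px; rewrite x00 /root horner_dstar_poly; lra.
Qed.

(** * Kronecker's theorem in dimension two *)

Section Kronecker.
Variable R : realType.
Implicit Types z : R[i].

Lemma norm_normc z : `|z| = (normc z)%:C. Proof. by []. Qed.

Lemma normc_ge0 z : 0 <= normc z.
Proof. by rewrite -lecR -norm_normc normr_ge0. Qed.

Lemma normcX z n : normc (z ^+ n) = normc z ^+ n.
Proof. by apply: complexI; rewrite rmorphXn /= -!norm_normc normrX. Qed.

Lemma normc_nat n : normc (n%:R : R[i]) = n%:R.
Proof. by apply: complexI; rewrite rmorph_nat -norm_normc normr_nat. Qed.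

Lemma normc_sum (I : Type) (r : seq I) (P : pred I) (F : I -> R[i]) :
  normc (\sum_(i <- r | P i) F i) <= \sum_(i <- r | P i) normc (F i).
Proof.
rewrite -lecR rmorph_sum /= -norm_normc; apply: le_trans (ler_norm_sum _ _ _) _.
by apply: ler_sum.
Qed.

Lemma normc_opp z : normc (- z) = normc z.
Proof. by apply: complexI; rewrite -!norm_normc normrN. Qed.

Lemma normc_distC (x y : R[i]) : normc (x - y) = normc (y - x).
Proof. by apply: complexI; rewrite -!norm_normc distrC. Qed.

Lemma normc_triangle (x y : R[i]) : normc (x + y) <= normc x + normc y.
Proof. by rewrite -lecR rmorphD /= -!norm_normc ler_normD. Qed.

(** For unimodular u, it converts a lower bound on |1 + u| into an upper bound on |1 - u|. *)
Lemma normc_parallelogram (x y : R[i]) :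
  normc (x + y) ^+ 2 + normc (x - y) ^+ 2 = (normc x ^+ 2 + normc y ^+ 2) *+ 2.
Proof.
have sq a b : normc (a +i* b) ^+ 2 = a ^+ 2 + b ^+ 2 :> R.
  by rewrite /= sqr_sqrtr // addr_ge0 ?sqr_ge0.
case: x y => [a b] [c d].
rewrite (_ : a +i* b - c +i* d = (a - c) +i* (b - d)) //.
rewrite (_ : a +i* b + c +i* d = (a + c) +i* (b + d)) //.
rewrite !sq; ring.
Qed.

(** Multiplied by 1 - z, the sum telescopes to 1 - z ^ n, of modulus at most 2; the bound is uniform
    in n. *)
Lemma geometric_sum_bound z n : normc z = 1 -> z != 1 ->
  normc (\sum_(k < n) z ^+ k) <= 2 / normc (1 - z).
Proof.
move=> nz z1; have d0 : 1 - z != 0 by rewrite subr_eq0 eq_sym.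
have d1 : 0 < normc (1 - z).
  by rewrite lt_neqAle normc_ge0 andbT eq_sym; apply/eqP => /eq0_normc /eqP; apply/negP.
rewrite ler_pdivlMr // -normcM mulrC.
rewrite -opprB mulNr -subrX1 opprB; apply: le_trans (normc_triangle _ _) _.
by rewrite -mulN1r normcM normcX nz expr1n normc_opp !normc1; lra.
Qed.

(* The mean of f(n) * z_i ^ (- n) over n < N tends to c_i, as the other
   frequencies contribute bounded geometric sums. *)
Lemma coef_le_of_bounded (I : finType) (c z : I -> R[i]) (B : R) :
  injective z -> (forall i, normc (z i) = 1) ->
  (forall n : nat, normc (\sum_i c i * z i ^+ n) <= B) ->
  forall i, normc (c i) <= B.
Proof.
move=> zinj nz fB i0; rewrite leNgt; apply/negP => ltB.
have z0 i : z i != 0.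
  by apply/eqP => zi; move: (nz i); rewrite zi normc0; lra.
pose D := \sum_(i | i != i0) normc (c i) * (2 / normc (1 - z i / z i0)).
have key N : N%:R * normc (c i0) <= N%:R * B + D.
  have E : \sum_(n < N) (\sum_i c i * z i ^+ n) * (z i0)^-1 ^+ n =
      N%:R * c i0 + \sum_(i | i != i0) c i * \sum_(n < N) (z i / z i0) ^+ n.
    under eq_bigr do rewrite mulr_suml.
    rewrite exchange_big /= (bigD1 i0) //=; congr (_ + _).
      under eq_bigr do rewrite -mulrA -exprMn divff // expr1n mulr1.
      by rewrite sumr_const card_ord mulr_natl.
    apply: eq_bigr => i _; rewrite mulr_sumr; apply: eq_bigr => n _.
    by rewrite -mulrA exprMn.
  have -> : N%:R * normc (c i0) = normc (N%:R * c i0).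
    by rewrite normcM normc_nat.
  move/(congr1 (fun x => x - \sum_(i | i != i0) c i * \sum_(n < N) (z i / z i0) ^+ n)): E.
  rewrite addrK => <-; apply: le_trans (normc_triangle _ _) _; rewrite normc_opp.
  apply: lerD.
    apply: le_trans (normc_sum _ _ _ _) _.
    rewrite -[N in leRHS]card_ord mulr_natl -sumr_const.
    apply: ler_sum => n _.
    by rewrite normcM normcX normcV nz invr1 expr1n mulr1.
  apply: le_trans (normc_sum _ _ _ _) _; apply: ler_sum => i ii0.
  rewrite normcM ler_wpM2l ?normc_ge0 // geometric_sum_bound //.
    by rewrite normcM normcV !nz divr1.
  by apply: contra ii0 => /eqP /(divr1_eq) /zinj ->.
have d0 : 0 < normc (c i0) - B by lra.
(* For this N, N (|c_i0| - B) exceeds D, against [key]. *)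
pose N := Num.bound (D / (normc (c i0) - B)).
have D0 : 0 <= D.
  by apply: sumr_ge0 => i _; rewrite mulr_ge0 ?divr_ge0 ?normc_ge0.
have := archi_boundP (divr_ge0 D0 (ltW d0)); rewrite ltr_pdivrMr // -/N.
by have := key N; lra.
Qed.

(** Take k = 3 m with m h ^ 3 > 16, where 4 / q = 1 + h. The cube of the Bernoulli-type bound (1 +
    h) ^ m >= m h gives (4 / q) ^ k >= m ^ 3 h ^ 3 > 16 m ^ 2 >= (3 m + 1) ^ 2. *)
Lemma poly_lt_exp (q : R) : 0 < q < 4 ->
  exists k : nat, k.+1%:R ^+ 2 * q ^+ k < 4 ^+ k.
Proof.
move=> /andP[q0 q4]; pose h := 4 / q - 1.
have h0 : 0 < h by rewrite subr_gt0 ltr_pdivlMr // mul1r.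
pose m := (Num.bound (16 / h ^+ 3)).+1.
have h30 : 0 < h ^+ 3 by rewrite exprn_gt0.
have m16 : 16 < m%:R * h ^+ 3.
  rewrite -ltr_pdivrMr //; apply: lt_trans (archi_boundP _) _.
    by rewrite divr_ge0 ?ltW.
  by rewrite ltr_nat.
have m1 : 1 <= m%:R :> R by rewrite ler1n.
have bern : m%:R * h <= (1 + h) ^+ m.
  elim: m {m16 m1} => [|n IH]; first by rewrite mul0r expr0.
  rewrite exprS -natr1; have : 1 <= (1 + h) ^+ n by rewrite exprn_ege1 // lerDl ltW.
  by nra.
exists (m * 3)%N; have -> : 4 ^+ (m * 3) = ((1 + h) ^+ m) ^+ 3 * q ^+ (m * 3).
  by rewrite -exprM -exprMn /h addrC subrK divfK // gt_eqF.
rewrite ltr_pM2r ?exprn_gt0 //.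
apply: (@lt_le_trans _ _ ((m%:R * h) ^+ 3)); last first.
  by rewrite lerXn2r // nnegrE ?exprn_ge0 ?mulr_ge0 //; lra.
have : m%:R ^+ 2 * 16 < m%:R ^+ 2 * (m%:R * h ^+ 3).
  by rewrite ltr_pM2l // exprn_gt0 // (lt_le_trans ltr01).
rewrite mulrA -exprSr -[(m * 3).+1%:R]natr1 natrM exprMn; apply: le_lt_trans.
by move: m%:R m1 => M M1; nra.
Qed.

(* If both distances were never small, |(1 + z1^n/w1) (1 + z2^n/w2)| would be
   at most q < 4 for all n. The coefficients of the k-th power of this
   exponential polynomial, of sum 4^k, would be at most q^k; but there are only
   (k+1)^2 of them. *)
Lemma kronecker2 (z1 z2 w1 w2 : R[i]) (e : R) :
  normc z1 = 1 -> normc z2 = 1 -> normc w1 = 1 -> normc w2 = 1 ->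
  (forall i j i' j' : nat, z1 ^+ i * z2 ^+ j = z1 ^+ i' * z2 ^+ j' ->
     i = i' /\ j = j') ->
  0 < e -> exists n : nat, normc (z1 ^+ n - w1) < e /\ normc (z2 ^+ n - w2) < e.
Proof.
move=> nz1 nz2 nw1 nw2 free e0.
(* The bound e <= 1 keeps the threshold [s] below positive. *)
wlog e1 : e e0 / e <= 1 => [wl|].
  have [||n [h1 h2]] := wl (Num.min e 1); rewrite ?lt_min ?e0 ?ltr01 ?ge_min ?lexx ?orbT //.
  by exists n; move: h1 h2; rewrite !lt_min => /andP[-> _] /andP[-> _].
have w10 : w1 != 0.
  by apply/eqP => w; move: nw1; rewrite w normc0; lra.
have w20 : w2 != 0.
  by apply/eqP => w; move: nw2; rewrite w normc0; lra.
(* Chosen so that 4 - s ^ 2 = e ^ 2 - e ^ 4 / 16 < e ^ 2: by the parallelogram law, |1 + u| > s then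
   forces |1 - u| < e. *)
pose s := 2 - e ^+ 2 / 4.
pose u1 n := z1 ^+ n / w1; pose u2 n := z2 ^+ n / w2.
have nu1 n : normc (u1 n) = 1.
  by rewrite normcM normcX normcV nz1 nw1 expr1n divr1.
have nu2 n : normc (u2 n) = 1.
  by rewrite normcM normcX normcV nz2 nw2 expr1n divr1.
have close (u : R[i]) : normc u = 1 -> s < normc (1 + u) -> normc (u - 1) < e.
  move=> nu su; rewrite normc_distC ltNge; apply/negP => ed.
  have := normc_parallelogram 1 u; rewrite nu normc1 !expr1n.
  have s0 : 0 < s by rewrite /s; nra.
  have : e ^+ 2 <= normc (1 - u) ^+ 2 by rewrite ler_pXn2r // nnegrE ?normc_ge0 ?ltW.
  have : s ^+ 2 < normc (1 + u) ^+ 2 by rewrite ltr_pXn2r // nnegrE ?normc_ge0 ?ltW.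
  have : s ^+ 2 = 4 - e ^+ 2 + e ^+ 4 / 16 by rewrite /s; field.
  have : 0 < e ^+ 4 by rewrite exprn_gt0.
  lra.
have le2 (u : R[i]) : normc u = 1 -> normc (1 + u) <= 2.
  by move=> nu; have := normc_triangle 1 u; rewrite nu normc1; lra.
(* Both factors have modulus at most 2, so a product above 2 s puts each of them above s. *)
have [[n ltn]|] := pselect (exists n, 2 * s < normc ((1 + u1 n) * (1 + u2 n))).
  exists n.
  have -> : z1 ^+ n - w1 = (u1 n - 1) * w1 by rewrite mulrBl divfK // mul1r.
  have -> : z2 ^+ n - w2 = (u2 n - 1) * w2 by rewrite mulrBl divfK // mul1r.
  rewrite !normcM nw1 nw2 !mulr1.
  move: ltn (le2 _ (nu1 n)) (le2 _ (nu2 n)); rewrite normcM.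
  move: (normc_ge0 (1 + u1 n)) (normc_ge0 (1 + u2 n)) => g1 g2 ltn l1 l2.
  by split; apply: close => //; nra.
move=> /forallNP nex.
have /poly_lt_exp[k] : 0 < 2 * s < 4 by apply/andP; split; rewrite /s; nra.
rewrite ltNge => /negP; case.
(* Coefficients and frequencies of the k-th power, from two binomial expansions; [free] makes the
   frequencies distinct. *)
pose c (p : 'I_k.+1 * 'I_k.+1) : R[i] :=
  ('C(k, p.1)%:R * w1^-1 ^+ p.1) * ('C(k, p.2)%:R * w2^-1 ^+ p.2).
pose z (p : 'I_k.+1 * 'I_k.+1) : R[i] := z1 ^+ p.1 * z2 ^+ p.2.
have nc p : normc (c p) = ('C(k, p.1) * 'C(k, p.2))%:R.
  rewrite !normcM !normcX !normcV nw1 nw2.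
  by rewrite !normc_nat invr1 !expr1n !mulr1 natrM.
have cle p : normc (c p) <= (2 * s) ^+ k.
  apply: (@coef_le_of_bounded _ c z) => [[i j] [i' j']|[i j]|n].
  - by move=> /free /= [/ord_inj-> /ord_inj->].
  - by rewrite normcM !normcX nz1 nz2 !expr1n mulr1.
  have -> : \sum_p c p * z p ^+ n = ((1 + u1 n) * (1 + u2 n)) ^+ k.
    have bin (u : R[i]) : (1 + u) ^+ k = \sum_(i < k.+1) 'C(k, i)%:R * u ^+ i.
      by rewrite exprDn; apply: eq_bigr => i _; rewrite expr1n mul1r mulr_natl.
    rewrite exprMn !bin big_distrlr /= pair_big /=; apply: eq_bigr => -[i j] _.
    rewrite /c /z /u1 /u2 /= !exprMn -!exprM ![(n * _)%N]mulnC.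
    move: ('C(k, i)%:R : R[i]) ('C(k, j)%:R : R[i]) (w1^-1 ^+ i) (w2^-1 ^+ j).
    move: (z1 ^+ _) (z2 ^+ _) => a1 a2 a3 a4 a5 a6.
    by ring.
  have := nex n; rewrite normcX => /negP; rewrite -leNgt => h.
  by rewrite lerXn2r // nnegrE ?normc_ge0 //; apply: le_trans h; exact: normc_ge0.
have -> : 4 ^+ k = \sum_p normc (c p) :> R.
  under eq_bigr do rewrite nc.
  rewrite -natr_sum; have -> : 4 = (2 * 2)%:R :> R by rewrite natrM; ring.
  rewrite -natrX expnMn; congr _%:R.
  have -> : (2 ^ k = \sum_(i < k.+1) 'C(k, i))%N.
    by rewrite -[2%N]/(1 + 1)%N expnDn; apply: eq_bigr => i _; rewrite !exp1n !muln1.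
  by rewrite big_distrlr /= pair_big.
apply: le_trans (ler_sum _ (fun p _ => cle p)) _.
by rewrite sumr_const card_prod card_ord expr2 -natrM [leRHS]mulr_natl.
Qed.

End Kronecker.

(** * Unimodular exponentials and the matrix exponential *)

Section Cis.
Variable R : realType.
Implicit Types t x y : R.

Definition cis t : R[i] := cos t +i* sin t.

Lemma cisD x y : cis (x + y) = cis x * cis y.
Proof. by rewrite /cis cosD sinD; congr Complex; ring. Qed.

Lemma cis0 : cis 0 = 1.
Proof. by rewrite /cis cos0 sin0. Qed.

Lemma normc_cis x : normc (cis x) = 1.
Proof. by rewrite /normc /= cos2Dsin2 sqrtr1. Qed.

Lemma cisN x : cis (- x) = (cis x)^-1.
Proof.
have c0 : cis x != 0.
  apply/eqP => c; move: (normc_cis x).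
  by rewrite c normc0; lra.
by apply: (mulfI c0); rewrite divff // -cisD subrr cis0.
Qed.

Lemma cisMn x n : cis (x *+ n) = cis x ^+ n.
Proof. by elim: n => [|n IH]; rewrite ?cis0 // mulrS cisD IH exprS. Qed.

Lemma cis_2pi_int (m : int) : cis (2 * pi * m%:~R) = 1.
Proof.
have c1 n : cis (2 * pi * n%:R) = 1.
  rewrite mulr_natr cisMn (_ : cis (2 * pi) = 1) ?expr1n //.
  by rewrite /cis mulr_natl cos2pi sin2pi.
case: m => n; first exact: c1.
by rewrite NegzE rmorphN mulrN cisN /= -pmulrn c1 invr1.
Qed.

(** The fractional part y of x satisfies cos(2 pi y) = 1, hence sin(pi y) = 0 with 0 <= pi y < pi,
    which leaves only y = 0. *)
Lemma cis_2pi_eq1 x : cis (2 * pi * x) = 1 -> exists m : int, x = m%:~R.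
Proof.
move=> cx; exists (Num.floor x); have /andP[fx xf] := floor_itv x.
set m := Num.floor x in fx xf *; pose y := x - m%:~R.
have y0 : 0 <= y by rewrite subr_ge0.
have y1 : y < 1 by rewrite ltrBlDl -[1]/(1%:~R) -intrD.
have cy : cis (2 * pi * y) = 1.
  by rewrite mulrBr cisD cx mul1r -mulrN -rmorphN /= cis_2pi_int.
have {}cy : cos ((pi * y) *+ 2) = 1 by case: cy => <- _; rewrite -mulr_natl mulrA.
have sy : sin (pi * y) = 0.
  apply/eqP; rewrite -sqrf_eq0 sin2cos2 subr_eq0 eq_sym; apply/eqP.
  by move: cy; rewrite cos_mulr2n; lra.
apply/eqP; rewrite -subr_eq0 -/y eq_le y0 andbT leNgt; apply/negP => yp.
have := @sin_gt0_pi R (pi * y); rewrite sy ltxx mulr_gt0 ?pi_gt0 //=.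
by rewrite gtr_pMr ?pi_gt0 // y1 => /(_ isT).
Qed.

Lemma cis_pihalf : cis (pi / 2) = 'i.
Proof. by rewrite /cis cos_pihalf sin_pihalf. Qed.

Lemma i_neq0 : 'i != 0 :> R[i].
Proof. by rewrite complexiE neq0Ci. Qed.

Lemma inv_i : 'i^-1 = - 'i :> R[i].
Proof. by apply: (mulfI i_neq0); rewrite divff ?i_neq0 // mulrN -expr2 sqr_i opprK. Qed.

Lemma expi_coeff (t : R) k : ('i * t%:C) ^+ k / k`!%:R = cos_coeff t k +i* sin_coeff t k.
Proof.
have i2 n : ('i : R[i]) ^+ n.*2 = ((-1) ^+ n)%:C.
  by rewrite -mul2n exprM sqr_i rmorphXn rmorphN1.
have -> : (k`!%:R : R[i]) = (k`!%:R)%:C by rewrite rmorph_nat.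
rewrite -fmorphV exprMn -rmorphXn /= /cos_coeff /sin_coeff /=.
have -> : ('i : R[i]) ^+ k = 'i ^+ odd k * ((-1) ^+ k./2)%:C.
  by rewrite -i2 -exprD odd_double_half.
case: (boolP (odd k)) => ok /=.
  have -> : k.-1./2 = k./2 by rewrite -{1}(odd_double_half k) ok /= doubleK.
  by rewrite expr1; simpc; congr Complex; ring.
by rewrite expr0; simpc; congr Complex; rewrite /exprz /=; ring.
Qed.

End Cis.
Arguments cis {R} t.

(** * Entrywise convergence and the exponential series *)

Lemma cvg_mx (T : topologicalType) m n (F : nat -> 'M[T]_(m, n)) (L : 'M[T]_(m, n)) :
  (forall i j, F k i j @[k --> \oo] --> L i j) -> F @ \oo --> L.
Proof.
move=> FL A [P LP PA].
suff : \forall k \near \oo, forall i j, P i j (F k i j).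
  by apply: filterS => k Pk; exact: PA.
by apply: filter_forall => i; apply: filter_forall => j; exact: FL.
Qed.

Lemma cvg_mx_entry (T : topologicalType) m n (F : nat -> 'M[T]_(m, n)) (L : 'M[T]_(m, n)) i j :
  F @ \oo --> L -> F k i j @[k --> \oo] --> L i j.
Proof.
move=> FL A LA; apply: (FL [set M : 'M[T]_(m, n) | A (M i j)]).
(* A box neighbourhood that constrains only the entry (i, j). *)
exists (fun i' j' => [set x | i' = i -> j' = j -> A x]).
  move=> i' j'; case: (boolP ((i' == i) && (j' == j))) => [/andP[/eqP-> /eqP->]|ne].
    by apply: filterS LA => x Ax _ _.
  by apply: filterS (@filterT _ (nbhs (L i' j')) _) => x _ ei ej; move: ne; rewrite ei ej !eqxx.
by move=> M /= h; apply: h.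
Qed.

Section Cexp.
Variable R : realType.
Local Notation C := (Cx R).

Lemma cvg_real_complex (u : R^nat) (a : R) :
  u @ \oo --> a -> ((u k)%:C : C) @[k --> \oo] --> (a%:C : C).
Proof.
move=> /cvgrPdist_lt ua; apply/cvgrPdist_lt => e e0.
(* Only real numbers are positive in the order of [R[i]], so the radius comes from some real [d]. *)
have [d ed] : exists d, e = d%:C by apply/complex_realP; exact: gtr0_real.
rewrite ed ltcR in e0 *; apply: filterS (ua _ e0) => k h.
by rewrite -rmorphB /= norm_normc /= expr0n addr0 sqrtr_sqr ltcR.
Qed.

Lemma cvg_complex (u : nat -> C) (a b : R) :
  complex.Re (u k) @[k --> \oo] --> a -> complex.Im (u k) @[k --> \oo] --> b ->
  u @ \oo --> (a +i* b : C).
Proof.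
move=> ua ub; rewrite (complexE (a +i* b)).
rewrite (_ : u = fun k => ((complex.Re (u k))%:C : C) + ('i : C) * ((complex.Im (u k))%:C : C)).
  by apply: cvgD; [|apply: cvgMl_tmp]; exact: cvg_real_complex.
by apply/funext => k; exact: complexE.
Qed.

Lemma cvg_expi (t : R) :
  \sum_(k < n) (('i * t%:C) ^+ k / k`!%:R : C) @[n --> \oo] --> (cis t : C).
Proof.
rewrite /cis; apply: cvg_complex.
  rewrite (_ : (fun _ => _) = series (cos_coeff t)).
    by rewrite cos.unlock; exact: is_cvg_series_cos_coeff.
  apply/funext => n; rewrite /series /= big_mkord.
  elim: n => [|n IH]; first by rewrite !big_ord0.
  by rewrite !big_ord_recr /= -IH expi_coeff; case: (\sum_(_ < _) _).
rewrite (_ : (fun _ => _) = series (sin_coeff t)).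
  by rewrite sin.unlock; exact: is_cvg_series_sin_coeff.
apply/funext => n; rewrite /series /= big_mkord.
elim: n => [|n IH]; first by rewrite !big_ord0.
by rewrite !big_ord_recr /= -IH expi_coeff; case: (\sum_(_ < _) _).
Qed.

Lemma normc_ge_Re_Im (z : R[i]) : `|complex.Re z| <= normc z /\ `|complex.Im z| <= normc z.
Proof.
case: z => a b /=; rewrite -!sqrtr_sqr; split; apply: ler_wsqrtr.
  by rewrite lerDl sqr_ge0.
by rewrite lerDr sqr_ge0.
Qed.

(** Comparison test, applied to the real and imaginary parts separately. *)
Lemma is_cvg_complex_series (u : nat -> C) (v : R^nat) :
  (forall k, normc (u k : R[i]) <= v k) -> cvgn (series v) ->
  exists l : C, \sum_(k < n) u k @[n --> \oo] --> l.
Proof.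
move=> uv cv.
have v0 k : 0 <= v k by apply: le_trans (uv k); exact: normc_ge0.
have cvg_part (f : R[i] -> R) : {morph f : x y / x + y} -> f 0 = 0 ->
    (forall z, `|f z| <= normc z) ->
    exists a : R, f (\sum_(k < n) u k) @[n --> \oo] --> a.
  move=> fD f0 fle; have cs : cvgn (series (fun k => f (u k))).
    apply: normed_cvg; apply: (series_le_cvg _ v0 _ cv) => k /=; first exact: normr_ge0.
    by apply: le_trans (uv k); exact: fle.
  exists (limn (series (fun k => f (u k)))).
  rewrite (_ : (fun _ => _) = series (fun k => f (u k))) //.
  by apply/funext => n; rewrite /series /= big_mkord (big_morph f fD f0).
have [|||a ca] := cvg_part (@complex.Re R); [by case=> ? ? []|by []|by move=> z; case: (normc_ge_Re_Im z)|].
have [|||b cb] := cvg_part (@complex.Im R); [by case=> ? ? []|by []|by move=> z; case: (normc_ge_Re_Im z)|].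
by exists (a +i* b); exact: cvg_complex.
Qed.

(** The sum of all moduli dominates every row sum, so each further factor [M] costs at most one
    factor of it. *)
Lemma normc_exprmx_le n (M : 'M[C]_n) k i j :
  normc ((M ^+ k) i j : R[i]) <= (\sum_a \sum_b normc (M a b : R[i])) ^+ k.
Proof.
set B := \sum_a _.
have row_le a : \sum_b normc (M a b : R[i]) <= B.
  rewrite [leRHS](bigD1 a) //= lerDl; apply: sumr_ge0 => a' _; apply: sumr_ge0 => b _.
  exact: normc_ge0.
elim: k i => [|k IH] i.
  rewrite !expr0 mxE; apply: (@le_trans _ _ (i == j)%:R); last by rewrite lern1 leq_b1.
  by rewrite -(normc_nat R (i == j)).
rewrite !exprS -mulmxE mxE; apply: le_trans (normc_sum _ _ _ _ _) _.
apply: (@le_trans _ _ (\sum_b normc (M i b : R[i]) * B ^+ k)).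
  by apply: ler_sum => b _; rewrite normcM ler_wpM2l ?normc_ge0.
rewrite -mulr_suml ler_wpM2r // exprn_ge0 //.
by apply: le_trans (row_le i); apply: sumr_ge0 => b _; exact: normc_ge0.
Qed.

(** [expmx] is a [lim], informative only once convergence is known. Each entry of the series is
    dominated by the real exponential series at [B]. *)
Lemma cvg_expmx n (M : 'M[C]_n) : expmx_partial M @ \oo --> expmx M.
Proof.
pose B := \sum_a \sum_b normc (M a b : R[i]).
have [L cL] : exists L : 'M[C]_n, forall i j,
    \sum_(k < N) ((k`!%:R)^-1 * (M ^+ k) i j) @[N --> \oo] --> L i j.
  suff /choice[L cL] : forall ij : 'I_n * 'I_n, exists l : C,
      \sum_(k < N) ((k`!%:R)^-1 * (M ^+ k) ij.1 ij.2) @[N --> \oo] --> l.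
    by exists (\matrix_(i, j) L (i, j)) => i j; rewrite mxE; exact: (cL (i, j)).
  move=> [i j] /=; pose u k : C := (k`!%:R)^-1 * (M ^+ k) i j.
  apply: (is_cvg_complex_series u (exp_coeff B)) (is_cvg_series_exp_coeff B) => k.
  rewrite normcM normcV normc_nat mulrC.
  by rewrite /exp_coeff /= ler_wpM2r ?invr_ge0 // normc_exprmx_le.
suff /cvgP : expmx_partial M @ \oo --> L by [].
apply: cvg_mx => i j; rewrite (_ : (fun _ => _) =
  fun N => \sum_(k < N) ((k`!%:R)^-1 * (M ^+ k) i j)) //.
apply/funext => N; rewrite /expmx_partial summxE.
by apply: eq_bigr => k _; rewrite mxE.
Qed.

(** On [v] the partial sums act as those of the scalar series for exp(i t); limits are unique. *)
Lemma expmx_eigen n (M : 'M[C]_n) (v : 'cV[C]_n) (t : R) :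
  M *m v = ('i * t%:C : C) *: v -> expmx M *m v = (cis t : C) *: v.
Proof.
move=> Mv; have Mkv k : M ^+ k *m v = (('i * t%:C : C) ^+ k) *: v.
  elim: k => [|k IH]; first by rewrite !expr0 mul1mx scale1r.
  by rewrite exprSr -mulmxE -mulmxA Mv -scalemxAr IH scalerA -exprS.
apply/matrixP => i j; rewrite !mxE.
have c1 : \sum_b (expmx_partial M N) i b * v b j @[N --> \oo] --> \sum_b (expmx M) i b * v b j.
  apply: cvg_big => [|b _]; first exact: add_continuous.
  by apply: cvgMr_tmp; apply: cvg_mx_entry; exact: cvg_expmx.
have c2 : \sum_b (expmx_partial M N) i b * v b j @[N --> \oo] --> (cis t : C) * v i j.
  rewrite (_ : (fun _ => _) = fun N => (\sum_(k < N) (('i * t%:C) ^+ k / k`!%:R : C)) * v i j).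
    by apply: cvgMr_tmp; exact: cvg_expi.
  apply/funext => N; have -> : \sum_b expmx_partial M N i b * v b j = (expmx_partial M N *m v) i j by rewrite mxE.
  rewrite /expmx_partial mulmx_suml summxE mulr_suml; apply: eq_bigr => k _.
  by rewrite -scalemxAl Mkv scalerA mxE; congr (_ * _); rewrite mulrC.
exact: (@norm_cvg_unique _ C _ _ _ _ c1 c2).
Qed.

End Cexp.

(** * Transfer times and eigenvectors *)

(** Since exp(i t x) = exp(2 pi i x) ^ n exp(- i pi x / 2), the target for the n-th power is i exp(i
    pi x / 2), and likewise for y. *)
Lemma dstar_kronecker (R : realType) l (x y e : R) : (0 < l)%N ->
  root (dstar_poly R l) x -> root (dstar_poly R l) y -> x != y -> 0 < e ->
  exists n : nat, let t := (4 * n%:Z - 1)%:~R * pi / 2 in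
    normc (cis (t * x) - 'i) < e /\ normc (cis (t * y) - 'i) < e.
Proof.
move=> l0 px py xy e0.
have ni : normc ('i : R[i]) = 1 by rewrite -(cis_pihalf R) normc_cis.
have nw (u : R) : normc ('i * cis (pi * u / 2)) = 1.
  by rewrite normcM ni normc_cis mulr1.
have [|n [nx ny]] := kronecker2 R (cis (2 * pi * x)) (cis (2 * pi * y))
  _ _ e (normc_cis _ _) (normc_cis _ _) (nw x) (nw y) _ e0.
  (* Two equal monomials give an integer relation between x, y and 1, excluded by
     [dstar_roots_free]. *)
  move=> i j i' j'; rewrite -!cisMn -!cisD => E.
  have [c Ec] : exists c : int, (i%:Z - i'%:Z)%:~R * x + (j%:Z - j'%:Z)%:~R * y = c%:~R.
    apply: cis_2pi_eq1; rewrite !rmorphB /= -!pmulrn.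
    have -> : 2 * pi * ((i%:R - i'%:R) * x + (j%:R - j'%:R) * y) =
      ((2 * pi * x) *+ i + (2 * pi * y) *+ j) -
      ((2 * pi * x) *+ i' + (2 * pi * y) *+ j') by ring.
    by rewrite cisD E -cisD subrr cis0.
  have [i0 j0] := dstar_roots_free _ _ _ _ _ _ _ l0 px py xy Ec.
  by split; lia.
exists n; have step (u : R) : normc (cis ((4 * n%:Z - 1)%:~R * pi / 2 * u) - 'i) =
    normc (cis (2 * pi * u) ^+ n - 'i * cis (pi * u / 2)).
  have -> : (4 * n%:Z - 1)%:~R * pi / 2 * u = (2 * pi * u) *+ n - pi * u / 2.
    by rewrite rmorphB rmorphM /= -!pmulrn; field.
  rewrite cisD cisMn -[LHS]mulr1 -[X in _ * X = _](normc_cis R (pi * u / 2)).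
  by rewrite -normcM mulrBl -[_ * cis _ * cis _]mulrA -cisD addNr cis0 mulr1.
by split; rewrite [ltLHS]step.
Qed.

(** Stage k uses precision 1 / (k + 1). The exact value of [cis (tau k)] is recorded in order to
    reach the third root 1 - x - y. *)
Lemma dstar_tau (R : realType) l (x y : R) : (0 < l)%N ->
  root (dstar_poly R l) x -> root (dstar_poly R l) y -> x != y ->
  exists tau : nat -> R,
    [/\ forall k, exists m : int, tau k = (4 * m - 1)%:~R * pi / 2,
        forall k, cis (tau k) = - 'i,
        (cis (tau k * x) : Cx R) @[k --> \oo] --> ('i : Cx R) &
        (cis (tau k * y) : Cx R) @[k --> \oo] --> ('i : Cx R)].
Proof.
move=> l0 px py xy.
have /choice[n nP] : forall k : nat, exists n : nat, let t := (4 * n%:Z - 1)%:~R * pi / 2 in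
    normc (cis (t * x) - 'i) < (k.+1%:R^-1 : R) /\ normc (cis (t * y) - 'i) < (k.+1%:R^-1 : R).
  by move=> k; apply: (@dstar_kronecker R l).
have cvg_of (u : nat -> R[i]) : (forall k, normc (u k - 'i) < (k.+1%:R^-1 : R)) ->
    (u k : Cx R) @[k --> \oo] --> ('i : Cx R).
  move=> ui; apply/cvgrPdist_lt => e e0.
  have [d ed] : exists d, e = d%:C by apply/complex_realP; exact: gtr0_real.
  rewrite ed ltcR in e0 *; near=> k; rewrite distrC norm_normc ltcR.
  apply: lt_trans (ui k) _; near: k.
  exact: (near_infty_natSinv_lt (PosNum e0)).
exists (fun k => (4 * (n k)%:Z - 1)%:~R * pi / 2); split=> [k|k||].
- by exists (n k).
- have -> : (4 * (n k)%:Z - 1)%:~R * pi / 2 = 2 * pi * (n k)%:Z%:~R - pi / 2 :> R.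
    by rewrite rmorphB rmorphM /=; field.
  by rewrite cisD cis_2pi_int mul1r cisN cis_pihalf inv_i.
- by apply: cvg_of => k; case: (nP k).
- by apply: cvg_of => k; case: (nP k).
Unshelve. all: by end_near. Qed.

(** * Eigenvectors of the adjacency matrix *)

Lemma sum_Tvert (V : nmodType) l (F : Tvert l -> V) :
  \sum_y F y = \sum_(s : bool) (F (s, None) +
    \sum_(i < l) (F (s, Some (i, true)) + F (s, Some (i, false)))).
Proof.
transitivity (\sum_(y : Tvert l) F (y.1, y.2)); first by apply: eq_bigr => -[].
rewrite -(pair_bigA _ (fun s v => F (s, v))) /=; apply: eq_bigr => s _.
rewrite (bigD1 None) //=; congr (_ + _).
rewrite (reindex_omap Some id) /=; last by case.
transitivity (\sum_(p : 'I_l * bool) F (s, Some (p.1, p.2))).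
  by apply: eq_big => [p|[i b] _]; rewrite ?eqxx.
rewrite -(pair_bigA _ (fun i b => F (s, Some (i, b)))) /=.
by apply: eq_bigr => i _; rewrite big_bool.
Qed.

Section Eigen.
Variables (R : realType) (l : nat).
Local Notation C := (Cx R).

(** Lets the spectral computations run on real functions of vertices instead of complex columns
    indexed by ordinals. *)
Definition vcol (f : Tvert l -> R) : 'cV[C]_(Tn l) := \col_j ((f (enum_val j))%:C : C).

Lemma vcolD f g : vcol f + vcol g = vcol (fun x => f x + g x).
Proof. by apply/matrixP => i j; rewrite !mxE rmorphD. Qed.

Lemma vcolZ (c : R) f : (c%:C : C) *: vcol f = vcol (fun x => c * f x).
Proof. by apply/matrixP => i j; rewrite !mxE rmorphM. Qed.

Lemma evec_vcol x : evec R x = vcol (fun y => (y == x)%:R).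
Proof.
apply/matrixP => i j; rewrite [RHS]mxE rmorph_nat /evec mxE ord1 eqxx andbT.
by rewrite -(inj_eq (@enum_rank_inj (Tvert l))) enum_valK.
Qed.

Lemma Tadjmx_vcol f : Tadjmx R l *m vcol f = vcol (fun x => \sum_y (Tadj x y)%:R * f y).
Proof.
apply/matrixP => i j; rewrite !mxE rmorph_sum /=.
rewrite (reindex (@enum_rank (Tvert l))) /=; last exact/onW_bij/enum_rank_bij.
by apply: eq_bigr => k _; rewrite !mxE enum_rankK rmorphM rmorph_nat.
Qed.

(* The swap of the two sides acts on this eigenvector by the sign e. *)
Definition dstar_eigfun (e m : R) (x : Tvert l) : R :=
  e ^+ x.1 * match x.2 with
             | None => m ^+ 2 - 1
             | Some (_, false) => m
             | Some (_, true) => 1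
             end.

(** The values 1, m, m ^ 2 - 1 along a branch solve the equation at pendant and middle vertices for
    every m; the cubic is the condition at a coalescence vertex, l m + e (m ^ 2 - 1) = m (m ^ 2 -
    1). *)
Lemma dstar_eigfunP (e m : R) x : e ^+ 2 = 1 ->
  m ^+ 3 - e * m ^+ 2 - l.+1%:R * m + e = 0 ->
  \sum_y (Tadj x y)%:R * dstar_eigfun e m y = m * dstar_eigfun e m x.
Proof.
move=> e2 em; rewrite sum_Tvert big_bool /dstar_eigfun /= /Tadj.
have em' : m * (m ^+ 2 - 1) = e * (m ^+ 2 - 1) + l%:R * m.
  by move: em; rewrite -natr1; lra.
have s1 (i : 'I_l) : \sum_(j < l) (j == i)%:R = 1 :> R.
  by rewrite (bigD1 i) //= eqxx big1 ?addr0 // => j /negPf->.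
have s2 (i : 'I_l) : \sum_(j < l) ((i == j) || false)%:R = 1 :> R.
  by rewrite -[RHS](s1 i); apply: eq_bigr => j _; rewrite orbF eq_sym.
case: x => [[] [[i []]|]] /=; rewrite ?eqxx /=.
all: rewrite !big_split /= -!mulr_suml ?s1 ?s2 ?sumr_const ?card_ord ?mul0rn ?expr1.
(* The two coalescence vertices; closing goal 3 moves the sixth case to position 5. *)
3: by rewrite [RHS]mulrCA em' [RHS]mulrDr [X in _ = X + _]mulrA -expr2 e2; ring.
5: by rewrite [RHS]mulrCA em'; ring.
all: by ring.
Qed.

Lemma Umx_eigen (e m t : R) : e ^+ 2 = 1 ->
  m ^+ 3 - e * m ^+ 2 - l.+1%:R * m + e = 0 ->
  Umx (Tadjmx R l) t *m vcol (dstar_eigfun e m) =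
  (cis (t * m) : C) *: vcol (dstar_eigfun e m).
Proof.
move=> e2 em; apply: expmx_eigen; rewrite -scalemxAl Tadjmx_vcol.
apply/matrixP => i j; rewrite !mxE dstar_eigfunP // !rmorphM /=.
by rewrite !mulrA.
Qed.

(* Half the Lagrange interpolation weights: over the three roots they sum to 0
   against 1 and x, and to 1/2 against x ^ 2. *)
Definition dstar_weight (x y z : R) : R := ((x - y) * (x - z) * 2)^-1.

(** The weights annihilate the entries 1 and m. At a coalescence vertex the symmetric and
    antisymmetric parts contribute 1/2 each up to sign: they add on side [s] and cancel on the
    other. *)
Lemma evec_eigen (x y z : R) (s : bool) : x != y -> x != z -> y != z ->
  let V e m : 'cV[C]_(Tn l) := vcol (dstar_eigfun e m) in
  let c p q r : C := (dstar_weight p q r)%:C in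
  let e : C := ((-1) ^+ s)%:C in
  evec R ((s, None) : Tvert l) =
    c x y z *: (V 1 x + e *: V (-1) (- x)) +
    c y x z *: (V 1 y + e *: V (-1) (- y)) +
    c z x y *: (V 1 z + e *: V (-1) (- z)).
Proof.
move=> xy xz yz V c e; rewrite /V /c /e {V c e} evec_vcol.
rewrite !(vcolZ, vcolD); congr vcol; apply/funext => w.
have nz : [&& x - y != 0, x - z != 0, y - x != 0, y - z != 0, z - x != 0 & z - y != 0].
  by rewrite !subr_eq0 xy xz yz ![_ == x]eq_sym [z == y]eq_sym xy xz yz.
move: nz => /and5P[h1 h2 h3 h4 /andP[h5 h6]].
rewrite /dstar_eigfun /dstar_weight.
case: w => [[] [[k []]|]] /=; case: s => /=; rewrite ?expr0 ?expr1.
all: field.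
all: by rewrite h1 h2 h3 h4 h5 h6.
Qed.

End Eigen.

(** * Passage to the limit and state transfer *)

Lemma cvg_mxD (K : numFieldType) m n (F G : nat -> 'M[K]_(m, n)) (A B : 'M[K]_(m, n)) :
  F @ \oo --> A -> G @ \oo --> B -> (F k + G k) @[k --> \oo] --> A + B.
Proof.
move=> FA GB; apply: cvg_mx => i j.
rewrite mxE (_ : (fun _ => _) = fun k => F k i j + G k i j).
  by apply: cvgD; exact: cvg_mx_entry.
by apply/funext => k; rewrite mxE.
Qed.

Lemma cvg_mxZ (K : numFieldType) m n (u : nat -> K) (a : K) (A : 'M[K]_(m, n)) :
  u @ \oo --> a -> (u k *: A) @[k --> \oo] --> a *: A.
Proof.
move=> ua; apply: cvg_mx => i j.
rewrite mxE (_ : (fun _ => _) = fun k => u k * A i j); first exact: cvgMr_tmp.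
by apply/funext => k; rewrite mxE.
Qed.

Theorem theorem3p2 (R : realType) (l : nat) (hl : (0 < l)%N) :
  exists tau : nat -> R,
    (forall k, exists m : int, tau k = (4 * m - 1)%:~R * pi / 2) /\
    exists gamma : Cx R,
      (fun k => Umx (Tadjmx R l) (tau k) *m evec R (coal_a l))
        @ \oo --> (gamma *: evec R (coal_b l) : 'cV[Cx R]_(Tn l)).
Proof.
have [x [y [px py ltxy]]] := dstar_roots R l hl.
have xy : x != y by rewrite lt_eqF.
have [tau [tauP tau_i cx cy]] := dstar_tau R l x y hl px py xy.
exists tau; split=> //; exists ('i : Cx R).
(* The third root, as the three roots sum to 1. *)
pose z := 1 - x - y.
(* Equality would read 2 x + y = 1, a forbidden integer relation. *)
have xz : x != z.
  apply/eqP => e; have := dstar_roots_free R l x y 2 1 1 hl px py xy.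
  by case; rewrite // mul1r; rewrite /z in e; lra.
have yz : y != z.
  apply/eqP => e; have := dstar_roots_free R l x y 1 2 1 hl px py xy.
  by case; rewrite // mul1r; rewrite /z in e; lra.
have pz : root (dstar_poly R l) z.
  move: px py; rewrite /root !horner_dstar_poly => /eqP px /eqP py.
  (* The second divided difference of the cubic at x, y, z is x + y + z - 1 = 0, so linear
     interpolation from x and y is exact at z. *)
  have : (x - y) * (z ^+ 3 - z ^+ 2 - l.+1%:R * z + 1) =
      (z - y) * (x ^+ 3 - x ^+ 2 - l.+1%:R * x + 1) -
      (z - x) * (y ^+ 3 - y ^+ 2 - l.+1%:R * y + 1) by rewrite /z; ring.
  by rewrite px py !mulr0 subr0 => /eqP; rewrite mulf_eq0 subr_eq0 (negPf xy).
have i0 := i_neq0 R.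
(* exp(i tau z) is exp(i tau) divided by the factors for x and y, so it tends to (- i) / (i i) =
   i. *)
have cz : (cis (tau k * z) : Cx R) @[k --> \oo] --> ('i : Cx R).
  have -> : 'i = (- 'i) * 'i^-1 * 'i^-1 :> R[i].
    by rewrite inv_i mulrNN -expr2 sqr_i mulN1r opprK.
  rewrite (_ : (fun _ => _) =
    fun k => (- 'i : Cx R) * (cis (tau k * x) : Cx R)^-1 * (cis (tau k * y) : Cx R)^-1).
    by apply: cvgM; [apply: cvgMl_tmp|]; apply: cvgV.
  by apply/funext => k; rewrite /z !mulrBr mulr1 !cisD !cisN tau_i.
have cN (u : R) : (cis (tau k * u) : Cx R) @[k --> \oo] --> ('i : Cx R) ->
    (cis (tau k * - u) : Cx R) @[k --> \oo] --> (- 'i : Cx R).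
  rewrite -inv_i.
  move=> cu; rewrite (_ : (fun _ => _) = fun k => (cis (tau k * u) : Cx R)^-1).
    by apply: cvgV.
  by apply/funext => k; rewrite mulrN cisN.
clearbody z.
pose V (e m : R) : 'cV[Cx R]_(Tn l) := vcol R l (dstar_eigfun R l e m).
pose a (p q r : R) : Cx R := (dstar_weight R p q r)%:C.
have UV (p : R) k : root (dstar_poly R l) p ->
    Umx (Tadjmx R l) (tau k) *m (V 1 p + V (-1) (- p)) =
    (cis (tau k * p) : Cx R) *: V 1 p + (cis (tau k * - p) : Cx R) *: V (-1) (- p).
  rewrite /root horner_dstar_poly => /eqP pp.
  by rewrite mulmxDr !Umx_eigen ?sqrrN ?expr1n //; lra.
(* The symmetric part is multiplied by i in the limit and the antisymmetric part by 1 / i = - i;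
   this relative sign turns the expansion of e_a into that of e_b. *)
have cV (p : R) (c : Cx R) : root (dstar_poly R l) p ->
    (cis (tau k * p) : Cx R) @[k --> \oo] --> ('i : Cx R) ->
    (c *: (Umx (Tadjmx R l) (tau k) *m (V 1 p + V (-1) (- p)))) @[k --> \oo] -->
    ('i : Cx R) *: (c *: (V 1 p - V (-1) (- p))).
  move=> pp cp; rewrite (_ : (fun _ => _) = fun k =>
      (cis (tau k * p) : Cx R) *: (c *: V 1 p) +
      (cis (tau k * - p) : Cx R) *: (c *: V (-1) (- p))); last first.
    apply/funext => k; rewrite UV // scalerDr !scalerA.
    by rewrite [c * cis (tau k * p)]mulrC [c * cis (tau k * - p)]mulrC.
  rewrite scalerBr scalerBr -scaleNr.
  by apply: cvg_mxD; apply: cvg_mxZ; [exact: cp|exact: (cN _ cp)].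
have ea := evec_eigen R l x y z false xy xz yz.
have eb := evec_eigen R l x y z true xy xz yz.
move: ea eb; rewrite /= expr0 expr1 rmorphN1 rmorph1 !scale1r !scaleN1r => ea eb.
rewrite /coal_a /coal_b ea eb.
rewrite (_ : (fun _ => _) = fun k =>
   a x y z *: (Umx (Tadjmx R l) (tau k) *m (V 1 x + V (-1) (- x))) +
   a y x z *: (Umx (Tadjmx R l) (tau k) *m (V 1 y + V (-1) (- y))) +
   a z x y *: (Umx (Tadjmx R l) (tau k) *m (V 1 z + V (-1) (- z)))); last first.
  by apply/funext => k; rewrite /a /V mulmxDr mulmxDr -!scalemxAr.
rewrite !(scalerDr 'i).
by apply: cvg_mxD; [apply: cvg_mxD|]; exact: cV.
Qed.
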